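(* Let $p\in(1,2]$. Then the Banach Lipschitz ideal $[\mathcal{T}_p^{\mathrm{Lip}_0},\|\cdot\|_{\mathcal{T}_p^{\mathrm{Lip}}}]$ is maximal.
   Context: For Banach spaces $X,E$, $\mathrm{Lip}_0(X,E)$ is the Banach space of Lipschitz maps $f:X\to E$ with $f(0)=0$, normed by $\mathrm{Lip}(f)=\sup_{x\ne y}\|f(x)-f(y)\|/\|x-y\|$. $(r_n)_{n\in\mathbb{N}}$ are the Rademacher functions on $[0,1]$. $f\in\mathrm{Lip}_0(X,E)$ has type $p$ if there is $C>0$ such that for all $N\in\mathbb{N}$, $(\lambda_1,\ldots,\lambda_N)\in\mathbb{R}^N$ and $(x_1,\ldots,x_N),(y_1,\ldots,y_N)\in X^N$, $$\left(\int_0^1\Big\|\sum_{k=1}^N\lambda_k r_k(t)(f(x_k)-f(y_k))\Big\|_E^2dt\right)^{1/2}\le C\left(\sum_{k=1}^N|\lambda_k|^p\|x_k-y_k\|_X^p\right)^{1/p}.$$ The set of such $f$ is $\mathcal{T}_p^{\mathrm{Lip}_0}(X,E)$ and $\|f\|_{\mathcal{T}_p^{\mathrm{Lip}}}$ is the infimum of all such $C$. The class of all such maps with this norm is a Banach Lipschitz ideal (the Lipschitz analogue of a Banach operator ideal). $\mathrm{FIN}(X)$ denotes the set of finite-dimensional subspaces of $X$, $\mathrm{COFIN}(E)$ the set of closed finite-codimensional subspaces of $E$; for $Z\in\mathrm{FIN}(X)$, $\iota_Z^X:Z\to X$ is the inclusion, and for $Y\in\mathrm{COFIN}(E)$, $q_Y^E:E\to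 E/Y$ is the quotient operator. For a Banach Lipschitz ideal $[\mathcal{A},\|\cdot\|_{\mathcal{A}}]$, the ideal $[\mathcal{A}^{\max},\|\cdot\|_{\mathcal{A}^{\max}}]$ has components $$\mathcal{A}^{\max}(X,E)=\Big\{f\in\mathrm{Lip}_0(X,E):\ \|f\|_{\mathcal{A}^{\max}}=\sup_{Z\in\mathrm{FIN}(X),\,Y\in\mathrm{COFIN}(E)}\|q_Y^E\circ f\circ\iota_Z^X\|_{\mathcal{A}}<\infty\Big\}.$$ $[\mathcal{A},\|\cdot\|_{\mathcal{A}}]$ is maximal if $[\mathcal{A},\|\cdot\|_{\mathcal{A}}]=[\mathcal{A}^{\max},\|\cdot\|_{\mathcal{A}^{\max}}]$, i.e. the components coincide with equal norms for all Banach spaces $X,E$. *)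

(* Defs.v *)
From HB Require Import structures.
From mathcomp Require Import all_boot all_order all_algebra generic_quotient.
From mathcomp Require Import ring_quotient.
From mathcomp Require Import all_classical all_reals all_analysis.

Set Implicit Arguments.
Unset Strict Implicit.
Unset Printing Implicit Defensive.

Import Order.TTheory GRing.Theory Num.Theory.
Import numFieldNormedType.Exports.

Local Open Scope classical_set_scope.
Local Open Scope ring_scope.
Local Open Scope quotient_scope.

Definition finite_dim (R : nzRingType) (V : lmodType R) : Prop :=
  exists n (b : 'I_n -> V), forall v, exists c : 'I_n -> R,
    v = \sum_(i < n) c i *: b i.

Section Subspace.
Variables (R : numFieldType) (V : normedModType R) (S : submodClosed V).

Definition subspace_type : Type := {x : V | x \in S}.
HB.instance Definition _ := [isSub of subspace_type for @sval V _].
HB.instance Definition _ := [Choice of subspace_type by <:].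
HB.instance Definition _ := [SubChoice_isSubLmodule of subspace_type by <:].

Let norm (x : subspace_type) : R := `|val x|.

Let normD x y : norm (x + y) <= norm x + norm y.
Proof. by rewrite /norm raddfD ler_normD. Qed.

Let normZ (l : R) x : norm (l *: x) = `|l| * norm x.
Proof. by rewrite /norm linearZ normrZ. Qed.

Let norm0 x : norm x = 0 -> x = 0.
Proof. by move=> /normr0_eq0 x0; apply: val_inj; rewrite x0 raddf0. Qed.

HB.instance Definition _ :=
  Lmodule_isNormed.Build R subspace_type normD normZ norm0.

Lemma subspace_normE (x : subspace_type) : `|x| = `|val x|.
Proof. by []. Qed.

End Subspace.

Section QuotientLmodule.
Variables (R : numFieldType) (V : lmodType R) (S : submodClosed V).

Let oppS : oppr_closed S.
Proof. by move=> x xS; rewrite -scaleN1r rpredZ. Qed.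

Definition submod_zmodClosed : zmodClosed V :=
  HB.pack (GRing.SubmodClosed.sort S) (GRing.isOppClosed.Build V S oppS).

Local Notation quot := (Quotient.quot submod_zmodClosed).

Definition quotient_type : Type := quot.
HB.instance Definition _ := GRing.Zmodule.on quotient_type.

Definition quot_map : V -> quotient_type := \pi_quot.

Lemma quot_mapB : {morph quot_map : x y / x - y}.
Proof. by move=> x y; rewrite /quot_map raddfB. Qed.

Lemma quot_mapD : {morph quot_map : x y / x + y}.
Proof. by move=> x y; rewrite /quot_map raddfD. Qed.

Lemma quot_map_eq x y : (quot_map x = quot_map y) <-> (x - y \in S).
Proof. by rewrite (Quotient.idealrBE submod_zmodClosed); split=> /eqP. Qed.

Lemma quot_map_surj q : exists x, quot_map x = q.
Proof. by exists (repr (q : quot)); exact: reprK. Qed.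

Let scale (a : R) (q : quotient_type) : quotient_type :=
  quot_map (a *: repr (q : quot)).

Let scaleE a x : scale a (quot_map x) = quot_map (a *: x).
Proof.
apply/quot_map_eq; rewrite -scalerBr rpredZ//.
by apply/quot_map_eq; exact: reprK.
Qed.

Let scaleA a b q : scale a (scale b q) = scale (a * b) q.
Proof. by have [x <-] := quot_map_surj q; rewrite !scaleE scalerA. Qed.

Let scale1 : left_id 1 scale.
Proof. by move=> q; have [x <-] := quot_map_surj q; rewrite scaleE scale1r. Qed.

Let scaleDr : right_distributive scale +%R.
Proof.
move=> a q r; have [x <-] := quot_map_surj q; have [y <-] := quot_map_surj r.
by rewrite -quot_mapD !scaleE scalerDr quot_mapD.
Qed.

Let scaleDl q : {morph scale^~ q : a b / a + b}.
Proof.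
by move=> a b; have [x <-] := quot_map_surj q; rewrite !scaleE scalerDl quot_mapD.
Qed.

HB.instance Definition _ :=
  GRing.Zmodule_isLmodule.Build R quotient_type scaleA scale1 scaleDr scaleDl.

Lemma quot_mapZ (a : R) x : quot_map (a *: x) = a *: quot_map x.
Proof. by rewrite -scaleE. Qed.

End QuotientLmodule.
Arguments quot_map {R V} S.

Record fin_subspace (R : realType) (X : normedModType R) := FinSubspace {
  fin_carrier : submodClosed X ;
  fin_carrierP : finite_dim (subspace_type fin_carrier) }.

Record cofin_subspace (R : realType) (E : normedModType R) := CofinSubspace {
  cofin_carrier : submodClosed E ;
  cofin_closed : closed [set x | x \in cofin_carrier] ;
  cofin_carrierP : finite_dim (quotient_type cofin_carrier) }.

Section CofinQuotientNorm.
Variables (R : realType) (E : normedModType R) (Y : cofin_subspace E).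

Definition cofin_quotient : Type := quotient_type (cofin_carrier Y).
HB.instance Definition _ := GRing.Lmodule.on cofin_quotient.

Local Notation pi := (quot_map (cofin_carrier Y) : E -> cofin_quotient).

Definition quotient_norm (q : cofin_quotient) : R :=
  inf [set `|e| | e in [set e : E | pi e = q]].

Lemma quotient_norm_le e : quotient_norm (pi e) <= `|e|.
Proof.
apply: ge_inf; last by exists e.
by exists 0 => _ [x _ <-]; exact: normr_ge0.
Qed.

Lemma quotient_norm_ge q (c : R) :
  (forall e, pi e = q -> c <= `|e|) -> c <= quotient_norm q.
Proof.
move=> h; apply: lb_le_inf.
  by have [e eq] := quot_map_surj q; exists `|e|, e.
by move=> _ [e /= /h ? <-].
Qed.

Lemma quotient_norm_lt q (c : R) : quotient_norm q < c ->
  exists2 e, pi e = q & `|e| < c.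
Proof.
move=> qc; apply: contrapT => h; move: qc; apply/negP; rewrite -leNgt.
by apply: quotient_norm_ge => e eq; rewrite leNgt; apply/negP => ec; apply: h; exists e.
Qed.

Let normD q r : quotient_norm (q + r) <= quotient_norm q + quotient_norm r.
Proof.
apply/ler_addgt0Pr => d d0.
have [|x <- xq] := @quotient_norm_lt q (quotient_norm q + d / 2).
  by rewrite ltrDl divr_gt0.
have [|y <- yr] := @quotient_norm_lt r (quotient_norm r + d / 2).
  by rewrite ltrDl divr_gt0.
rewrite -[_ + _ in leLHS]/(quot_map _ x + quot_map _ y) -quot_mapD.
apply: (le_trans (quotient_norm_le _)); apply: (le_trans (ler_normD _ _)).
by rewrite (le_trans (lerD (ltW xq) (ltW yr)))// addrACA -splitr.
Qed.

Let normZ (l : R) q : quotient_norm (l *: q) = `|l| * quotient_norm q.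
Proof.
have le (k : R) r : quotient_norm (k *: r) <= `|k| * quotient_norm r.
  have [->|k0] := eqVneq k 0.
    rewrite normr0 mul0r; have [x <-] := quot_map_surj r.
    rewrite -[_ *: _ in leLHS]/(0 *: quot_map _ x) -quot_mapZ scale0r.
    by rewrite -(@normr0 _ E) quotient_norm_le.
  rewrite -ler_pdivrMl ?normr_gt0//.
  apply: quotient_norm_ge => x <-; rewrite ler_pdivrMl ?normr_gt0// -normrZ.
  by rewrite -[_ *: _ in leLHS]/(k *: quot_map _ x) -quot_mapZ quotient_norm_le.
apply/eqP; rewrite eq_le le /=.
have [->|l0] := eqVneq l 0.
  by rewrite normr0 mul0r; apply: quotient_norm_ge.
rewrite -ler_pdivlMl ?normr_gt0// -normfV.
by rewrite -{1}(scalerK l0 q) le.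
Qed.

Let norm0 q : quotient_norm q = 0 -> q = 0.
Proof.
have [x <-] := quot_map_surj q => x0.
suff xY : x \in cofin_carrier Y.
  rewrite -[RHS](_ : quot_map (cofin_carrier Y) 0 = _).
    by apply/quot_map_eq; rewrite subr0.
  by rewrite -(subrr (quot_map _ 0)) -quot_mapB subrr.
apply: (@cofin_closed _ _ Y) => B /nbhs_ballP[d /= d0 xdB].
have [|y yx yd] := @quotient_norm_lt (pi x) d; first by rewrite x0.
exists (x - y); split; first by apply/quot_map_eq.
by apply: xdB; rewrite -ball_normE /= subKr.
Qed.

HB.instance Definition _ :=
  Lmodule_isNormed.Build R cofin_quotient normD normZ norm0.

Lemma cofin_quotient_normE (q : cofin_quotient) : `|q| = quotient_norm q.
Proof. by []. Qed.

End CofinQuotientNorm.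

Lemma cauchy_image (R : realType) (V W : normedModType R) (A : set V)
    (f : V -> W) (k : R) (F : set_system V) : ProperFilter F ->
  F A -> (forall u v, A u -> A v -> `|f u - f v| <= k * `|u - v|) ->
  cauchy F -> cauchy (f @ F).
Proof.
move=> FF FA fL Fc; apply: cauchy_exP => _/posnumP[r].
have k1 : 0 < `|k| + 1 by rewrite ltr_wpDl.
have Fb : \forall x & y \near F, ball x (r%:num / (`|k| + 1)) y.
  by move/cauchy_ballP : Fc; apply; rewrite divr_gt0.
near F => x; have Ax : A x by near: x.
exists (f x).
have : \forall y \near F, ball x (r%:num / (`|k| + 1)) y.
  by near: x; exact: (@nearP_dep _ _ F F).
move=> xF; apply: filterS2 (FA) xF => y Ay; rewrite -!ball_normE /= => xy.
apply: (le_lt_trans (fL _ _ Ax Ay)).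
have kx : k * `|x - y| <= (`|k| + 1) * `|x - y|.
  by rewrite ler_wpM2r// (le_trans (ler_norm k))// lerDl.
by rewrite (le_lt_trans kx)// -ltr_pdivlMl// mulrC.
Unshelve. all: by end_near. Qed.

Section FiniteDimComplete.
Variables (R : realType) (V : normedModType R).

Definition lin_span n (b : 'I_n -> V) : set V :=
  [set v | exists c : 'I_n -> R, v = \sum_(i < n) c i *: b i].

Lemma lin_spanD n (b : 'I_n -> V) u v :
  lin_span b u -> lin_span b v -> lin_span b (u + v).
Proof.
move=> [c ->] [d ->]; exists (fun i => c i + d i).
by rewrite -big_split; apply: eq_bigr => i _; rewrite scalerDl.
Qed.

Lemma lin_spanZ n (b : 'I_n -> V) a v : lin_span b v -> lin_span b (a *: v).
Proof.
move=> [c ->]; exists (fun i => a * c i).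
by rewrite scaler_sumr; apply: eq_bigr => i _; rewrite scalerA.
Qed.

Lemma lin_span_recr n (b : 'I_n.+1 -> V) v :
  lin_span b v <-> exists2 w, lin_span (b \o lift ord0) w &
                    exists a, v = a *: b ord0 + w.
Proof.
split=> [[c ->]|[_ [c ->] [a ->]]].
  rewrite big_ord_recl; exists (\sum_(i < n) c (lift ord0 i) *: b (lift ord0 i)).
    by exists (c \o lift ord0).
  by exists (c ord0).
exists (fun i => oapp c a (unlift ord0 i)).
rewrite big_ord_recl unlift_none; congr (_ + _).
by apply: eq_bigr => i _; rewrite liftK.
Qed.

Definition set_complete (A : set V) := forall F : set_system V,
  ProperFilter F -> F A -> cauchy F -> exists2 v, A v & F --> v.

Lemma set_complete_span n (b : 'I_n -> V) : set_complete (lin_span b).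
Proof.
elim: n b => [|n IHn] b F FF FA Fc.
  have A0 v : lin_span b v -> v = 0 by move=> [c ->]; rewrite big_ord0.
  exists 0; first by exists (fun=> 0); rewrite big_ord0.
  move=> B /nbhs_singleton B0; apply: filterS FA => v /A0 ->; exact: B0.
pose W := lin_span (b \o lift ord0); pose e := b ord0.
have [We|nWe] := pselect (W e).
  have Wb v : lin_span b v -> W v.
    move=> /lin_span_recr [w Ww [a ->]]; apply: lin_spanD => //.
    exact: lin_spanZ.
  have [v Wv Fv] := IHn (b \o lift ord0) F FF (filterS Wb FA) Fc.
  exists v => //; apply/lin_span_recr; exists v => //; exists 0.
  by rewrite scale0r add0r.
have [d d0 dW] : exists2 d : R, 0 < d & forall w, W w -> d <= `|e + w|.
  apply: contrapT => h.
  have We' d : 0 < d -> exists2 w, W w & `|e - w| < d.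
    move=> d0; apply: contrapT => h'; apply: h; exists d => // w Ww.
    rewrite leNgt; apply/negP => ewd; apply: h'; exists (- w).
      by rewrite -scaleN1r; exact: lin_spanZ.
    by rewrite opprK.
  pose G := within W (nbhs e).
  have eW : closure W e.
    move=> B /nbhs_ballP[r /= r0 rB].
    have [w Ww ewr] := We' r r0; exists w; split => //; apply: rB.
    by rewrite -ball_normE.
  have GP : ProperFilter G := within_nbhs_proper eW.
  have Ge : G --> e by move=> B eB; apply: filterS eB => v.
  have Gc : cauchy G by apply: (@cvg_cauchy V); exact: (cvgP e Ge).
  have GW : G W by exact: withinT.
  have [v Wv Gv] := IHn (b \o lift ord0) G GP GW Gc.
  suff ev : e = v by apply: nWe; rewrite ev.
  exact: (cvg_unique (@norm_hausdorff _ V) Ge Gv).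
have /choice[a aP] : forall v, exists a : R, lin_span b v -> W (v - a *: e).
  move=> v; have [/lin_span_recr[w Ww [a ->]]|nv] := pselect (lin_span b v).
    by exists a => _; rewrite addrC addKr.
  by exists 0.
have aL u v : lin_span b u -> lin_span b v -> d * `|a u - a v| <= `|u - v|.
  move=> bu bv; have [->|auv] := eqVneq (a u) (a v).
    by rewrite subrr normr0 mulr0.
  have {}auv : a u - a v != 0 by rewrite subr_eq0.
  rewrite -ler_pdivlMr ?normr_gt0// -normfV mulrC -normrZ.
  set k := (_ - _)^-1.
  have -> : k *: (u - v) = e + k *: ((u - a u *: e) - (v - a v *: e)).
    have -> : (u - a u *: e) - (v - a v *: e) = (u - v) - (a u - a v) *: e.
      by rewrite scalerBl !opprD !opprK addrACA.
    by rewrite [in RHS]scalerBr scalerA mulVf// scale1r [RHS]addrC subrK.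
  apply: dW; apply: lin_spanZ; apply: lin_spanD; first exact: aP.
  by rewrite -scaleN1r; apply: lin_spanZ; exact: aP.
have aL' u v : lin_span b u -> lin_span b v -> `|a u - a v| <= d^-1 * `|u - v|.
  by move=> bu bv; rewrite ler_pdivlMl// aL.
have aFc : cauchy (a @ F) := @cauchy_image R V R^o _ a _ F FF FA aL' Fc.
have [a0 aF] : exists l : R, a @ F --> l by exists (lim (a @ F)); exact: (@R_complete R _ _ aFc).
have Fc' : cauchy ((fun v => v - a v *: e) @ F).
  apply: (@cauchy_image _ _ _ _ _ (1 + d^-1 * `|e|) _ _ FA _ Fc) => u v bu bv.
  rewrite opprD addrACA -opprD -scalerBl (le_trans (ler_normB _ _))//.
  by rewrite normrZ mulrDl mul1r lerD2l mulrAC ler_wpM2r// aL'.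
have FW : ((fun v => v - a v *: e) @ F) W.
  have h : F [set v | W (v - a v *: e)] by apply: (filterS _ FA) => v /aP.
  exact: h.
have [w Ww Fw] := IHn (b \o lift ord0) _ _ FW Fc'.
exists (a0 *: e + w); first by apply/lin_span_recr; exists w => //; exists a0.
have : (fun v => a v *: e + (v - a v *: e)) @ F --> a0 *: e + w.
  by apply: cvgD => //; exact: cvgZr_tmp.
by under eq_fun do rewrite addrC subrK.
Qed.

End FiniteDimComplete.

Section FinSubspaceComplete.
Variables (R : realType) (X : normedModType R) (Z : fin_subspace X).

Definition fin_subspace_type : Type := subspace_type (fin_carrier Z).
HB.instance Definition _ :=
  NormedModule.copy fin_subspace_type (subspace_type (fin_carrier Z)).

Lemma fin_subspace_complete (F : set_system fin_subspace_type) :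
  ProperFilter F -> cauchy F -> cvg F.
Proof.
move=> FF Fc; have [n [b bP]] := fin_carrierP Z.
have [|v _ Fv] := @set_complete_span R fin_subspace_type n b F FF _ Fc.
  by apply: filterS filterT => v _; exact: bP.
by apply/cvg_ex; exists v.
Qed.

HB.instance Definition _ :=
  Uniform_isComplete.Build fin_subspace_type fin_subspace_complete.

End FinSubspaceComplete.

Section CofinQuotientComplete.
Variables (R : realType) (E : completeNormedModType R) (Y : cofin_subspace E).

Lemma cofin_quotient_complete (F : set_system (cofin_quotient Y)) :
  ProperFilter F -> cauchy F -> cvg F.
Proof.
move=> FF Fc; have [n [b bP]] := cofin_carrierP Y.
have [|v _ Fv] := @set_complete_span R (cofin_quotient Y) n b F FF _ Fc.
  by apply: filterS filterT => v _; exact: bP.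
by apply/cvg_ex; exists v.
Qed.

HB.instance Definition _ :=
  Uniform_isComplete.Build (cofin_quotient Y) cofin_quotient_complete.

End CofinQuotientComplete.

Definition fin_incl (R : realType) (X : normedModType R) (Z : fin_subspace X) :
  fin_subspace_type Z -> X := val.

Definition cofin_quot_map (R : realType) (E : normedModType R)
    (Y : cofin_subspace E) : E -> cofin_quotient Y :=
  quot_map (cofin_carrier Y).

Definition Lip0 (R : realType) (X E : normedModType R) : set (X -> E) :=
  [set f | (exists k : R, k.-lipschitz f) /\ f 0 = 0].

(* Only the data (components and norms) of a Banach Lipschitz ideal: these are
   all that [lip_max] and [lip_maximal] depend on. The values of [lip_norm]
   outside the component are irrelevant. *)
Record lip_class (R : realType) := LipClass {
  lip_component : forall X E : completeNormedModType R, set (X -> E) ;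
  lip_norm : forall X E : completeNormedModType R, (X -> E) -> R ;
  lip_component_Lip0 : forall X E : completeNormedModType R,
    @lip_component X E `<=` @Lip0 R X E }.
Arguments lip_component {R} _ X E.
Arguments lip_norm {R} _ {X E} f.

Section Maximal.
Variables (R : realType) (A : lip_class R).

(* the usual convention that the norm is +oo outside the component *)
Definition lip_enorm (X E : completeNormedModType R) (f : X -> E) : \bar R :=
  if `[< lip_component A X E f >] then (lip_norm A f)%:E else +oo%E.

Definition lip_max_enorm (X E : completeNormedModType R) (f : X -> E) : \bar R :=
  ereal_sup [set lip_enorm (cofin_quot_map ZY.2 \o f \o @fin_incl R X ZY.1)
            | ZY in [set: fin_subspace X * cofin_subspace E]].

Definition lip_max_component (X E : completeNormedModType R) : set (X -> E) :=
  [set f | @Lip0 R X E f /\ (lip_max_enorm f < +oo)%E].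

Lemma lip_max_component_Lip0 (X E : completeNormedModType R) :
  @lip_max_component X E `<=` @Lip0 R X E.
Proof. by move=> f []. Qed.

Definition lip_max : lip_class R :=
  LipClass (fun X E f => fine (@lip_max_enorm X E f)) lip_max_component_Lip0.

Definition lip_maximal : Prop :=
  forall X E : completeNormedModType R,
    lip_component A X E = lip_component lip_max X E /\
    forall f : X -> E, lip_component A X E f -> lip_norm A f = lip_norm lip_max f.

End Maximal.

Definition rademacher (R : realType) (n : nat) (t : R) : R :=
  Num.sg (sin (2 ^+ n * pi * t)).

Section TypeP.
Variables (R : realType) (p : R).

(* The Rademacher functions r_1, ..., r_N are indexed from 1, whence k.+1. The
   integrand is a bounded step function, so that its real-valued Lebesgue
   integral is the genuine one. *)
Definition type_ineq (X E : normedModType R) (f : X -> E) (C : R) : Prop :=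
  forall (N : nat) (lambda : 'I_N -> R) (x y : 'I_N -> X),
    Num.sqrt (\int[lebesgue_measure]_(t in `[0, 1])
      (`| \sum_(k < N) (lambda k * rademacher k.+1 t) *: (f (x k) - f (y k)) | ^+ 2))
    <= C * (\sum_(k < N) `|lambda k| `^ p * `|x k - y k| `^ p) `^ p^-1.

Definition type_consts (X E : normedModType R) (f : X -> E) : set R :=
  [set C | 0 < C /\ type_ineq f C].

Definition type_component (X E : completeNormedModType R) : set (X -> E) :=
  [set f | @Lip0 R X E f /\ type_consts f !=set0].

Lemma type_component_Lip0 (X E : completeNormedModType R) :
  @type_component X E `<=` @Lip0 R X E.
Proof. by move=> f []. Qed.

Definition type_class : lip_class R :=
  LipClass (fun X E f => inf (@type_consts X E f)) type_component_Lip0.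

End TypeP.

(* Main.v *)
(* For data x_1, ..., x_N, y_1, ..., y_N in X only the finite-dimensional span Z
   of these points matters, and the Rademacher sum takes finitely many values in
   E. Hahn-Banach gives a norm-one functional norming each of these values; their
   common kernel Y is closed of finite codimension, and the quotient map E -> E/Y
   preserves the norm of each value exactly. Hence the type inequality for
   q_Y o f o i_Z on these data is the one for f. Conversely q_Y o f o i_Z
   inherits every type constant of f since q_Y is a contraction.

   Hahn-Banach is obtained by applying Zorn's lemma to sublinear functionals
   rather than to partially defined linear ones: a pointwise minimal sublinear
   functional is linear. *)
From HB Require Import structures.
Require Import Defs.
From mathcomp Require Import all_boot all_order all_algebra.
From mathcomp Require Import all_classical all_reals all_analysis.
From mathcomp Require Import lra.

Set Implicit Arguments.
Unset Strict Implicit.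
Unset Printing Implicit Defensive.

Import Order.TTheory GRing.Theory Num.Theory.
Import numFieldNormedType.Exports.

Local Open Scope classical_set_scope.
Local Open Scope ring_scope.

(** * Hahn-Banach theorem through minimal sublinear functionals *)

Section HahnBanach.
Variables (R : realType) (E : lmodType R).
Implicit Types (s : E -> R) (A : set (E -> R)).

Definition sublinear s :=
  (forall x y, s (x + y) <= s x + s y) /\
  (forall a x, 0 < a -> s (a *: x) <= a * s x).

Lemma sublinear0 s : sublinear s -> s 0 = 0.
Proof.
move=> [sD sZ]; have := sD 0 0; have := sZ 2^-1 0; rewrite scaler0 addr0.
by rewrite invr_gt0 ltr0n => /(_ isT); lra.
Qed.

Lemma sublinear_ge s x : sublinear s -> - s (- x) <= s x.
Proof.
by move=> ss; have := ss.1 x (- x); rewrite subrr sublinear0//; lra.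
Qed.

Lemma sublinearZ s a x : sublinear s -> 0 <= a -> s (a *: x) = a * s x.
Proof.
move=> ss; rewrite le_eqVlt => /predU1P[<-|a0].
  by rewrite scale0r mul0r sublinear0.
apply/eqP; rewrite eq_le ss.2//= -ler_pdivlMl//.
by rewrite -{1}(scalerK (lt0r_neq0 a0) x) ss.2// invr_gt0.
Qed.

Definition pinf A (x : E) : R := inf [set s x | s in A].

Lemma pinf_le A (l : E -> R) s x :
  (forall s x, A s -> l x <= s x) -> A s -> pinf A x <= s x.
Proof.
move=> lA As; apply: ge_inf; last by exists s.
by exists (l x) => _ [t At <-]; exact: lA.
Qed.

Lemma pinf_ge A c x : A !=set0 ->
  (forall s, A s -> c <= s x) -> c <= pinf A x.
Proof.
move=> [s As] h; apply: lb_le_inf; first by exists (s x), s.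
by move=> _ [t At <-]; exact: h.
Qed.

(** The bound [l] keeps the infimum real, and the last two hypotheses provide one member of [A]
    below each sum or multiple. This covers both the family that defines [subl_at] and the chains in
    Zorn's lemma. *)
Lemma sublinear_pinf A (l : E -> R) : A !=set0 ->
  (forall s x, A s -> l x <= s x) ->
  (forall s t, A s -> A t ->
    exists2 u, A u & forall x y, u (x + y) <= s x + t y) ->
  (forall a s, 0 < a -> A s ->
    exists2 u, A u & forall x, u (a *: x) <= a * s x) ->
  sublinear (pinf A).
Proof.
move=> A0 lA AD AZ; split=> [x y|a x a0].
  rewrite -lerBlDr; apply: pinf_ge => // s As.
  rewrite lerBlDr [leRHS]addrC -lerBlDr; apply: pinf_ge => // t At.
  rewrite lerBlDr [leRHS]addrC; have [u Au ust] := AD _ _ As At.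
  exact: le_trans (pinf_le _ lA Au) (ust _ _).
rewrite -ler_pdivrMl//; apply: pinf_ge => // s As; rewrite ler_pdivrMl//.
have [u Au us] := AZ _ _ a0 As.
exact: le_trans (pinf_le _ lA Au) (us _).
Qed.

(* The largest sublinear functional below [s] that takes the value [- s v]
   at [- v]. It makes a minimal sublinear functional additive, and, for the norm,
   forces the functionals below it to norm [v]. *)
Definition subl_at s v : E -> R :=
  pinf [set fun x => s (x + t *: v) - t * s v | t in [set t | 0 <= t]].

(** As (x + t v) + (-x) = t v, subadditivity gives t s(v) <= s(x + t v) + s(-x). *)
Let subl_at_lb s v u x : sublinear s ->
  [set fun x => s (x + t *: v) - t * s v | t in [set t | 0 <= t]] u ->
  - s (- x) <= u x.
Proof.
move=> ss [t /= t0 <-]; rewrite -sublinearZ//.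
have := ss.1 (x + t *: v) (- x).
by rewrite [x + _]addrC addrK; lra.
Qed.

Lemma sublinear_subl_at s v : sublinear s -> sublinear (subl_at s v).
Proof.
move=> ss; apply: (@sublinear_pinf _ (fun x => - s (- x))).
- by exists (fun x => s (x + 0 *: v) - 0 * s v), 0 => /=.
- by move=> u x; exact: subl_at_lb.
- move=> _ _ [t /= t0 <-] [t' /= t'0 <-].
  eexists; first by exists (t + t'); [rewrite /= addr_ge0|reflexivity].
  move=> x y /=; rewrite scalerDl addrACA.
  by have := ss.1 (x + t *: v) (y + t' *: v); lra.
- move=> a _ a0 [t /= t0 <-].
  eexists; first by exists (a * t); [rewrite /= mulr_ge0// ltW|reflexivity].
  move=> x /=; rewrite -scalerA -scalerDr mulrBr -mulrA lerB//.
  exact: ss.2.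
Qed.

Lemma subl_at_le s v t x : sublinear s -> 0 <= t ->
  subl_at s v x <= s (x + t *: v) - t * s v.
Proof.
move=> ss t0; apply: (@pinf_le _ (fun x => - s (- x)) (fun x => _ - _)).
  by move=> ? ?; exact: subl_at_lb.
by exists t.
Qed.

Lemma subl_at_le_self s v x : sublinear s -> subl_at s v x <= s x.
Proof.
by move=> /(subl_at_le v x)/(_ (lexx 0)); rewrite scale0r addr0 mul0r subr0.
Qed.

Lemma minimal_sublinear (p : E -> R) : sublinear p ->
  exists s, [/\ sublinear s, forall x, s x <= p x &
    forall t, sublinear t -> (forall x, t x <= s x) -> t = s].
Proof.
move=> sp; pose T := {s | sublinear s /\ forall x, s x <= p x}.
(* The order is reversed, so that a maximal element for Zorn is a minimal functional. *)
pose below (s t : T) := `[< forall x, sval t x <= sval s x >].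
pose p0 : T := exist _ p (conj sp (fun=> lexx _)).
have [|||[s [ss sp']] smin] := @ZL_preorder T p0 below.
- by move=> s; apply/asboolP.
- move=> t s u /asboolP st /asboolP tu; apply/asboolP => x.
  exact: le_trans (tu x) (st x).
- move=> B Btot; have [B0|nB0] := pselect (B !=set0); last first.
    (* The empty chain is treated apart: its infimum would be the default value 0, which may exceed
       [p]. *)
    by exists p0 => s Bs; case: nB0; exists s.
  pose A := sval @` B.
  have lA s x : A s -> - p (- x) <= s x.
    move=> [[t [tt tp]] Bt <-] /=.
    by apply: le_trans (sublinear_ge x tt); rewrite lerN2.
  have sA s : A s -> sublinear s by move=> [[t [tt tp]] _ <-].
  have A0 : A !=set0 by case: B0 => t Bt; exists (sval t), t.
  have sinf : sublinear (pinf A).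
    apply: sublinear_pinf lA _ _ => //.
      move=> s t As At; have [sD _] := sA _ As; have [tD _] := sA _ At.
      have [[s' Bs' s's] [t' Bt' t't]] := (As, At).
      (* The smaller of two members of the chain serves as the common lower member. *)
      have [/asboolP|/asboolP] := Btot _ _ Bs' Bt'; rewrite s's t't => st.
        by exists t => // x y; rewrite (le_trans (tD x y))// lerD.
      by exists s => // x y; rewrite (le_trans (sD x y))// lerD.
    by move=> a s a0 As; exists s => // x; exact: (sA _ As).2 _ _ a0.
  have pinf_lep x : pinf A x <= p x.
    have [s As] := A0; apply: le_trans (pinf_le x lA As) _.
    by case: As => -[t [tt tp]] ? <-; exact: tp.
  exists (exist _ (pinf A) (conj sinf pinf_lep)) => s Bs.
  by apply/asboolP => x /=; apply: pinf_le lA _; exists s.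
exists s; split=> // t st ts.
have tp x : t x <= p x := le_trans (ts x) (sp' x).
apply/funext => x; apply/eqP; rewrite eq_le ts /=.
have /asboolP := smin (exist _ t (conj st tp)) (introT (asboolP _) ts).
exact.
Qed.

Theorem hahn_banach (p : E -> R) : sublinear p ->
  exists phi : {scalar E}, forall x, phi x <= p x.
Proof.
move=> /minimal_sublinear[s [ss sp smin]].
have sD x y : s (x + y) = s x + s y.
  apply/eqP; rewrite eq_le ss.1 /=.
  (* By minimality [subl_at s y] is [s]; its bound for t = 1 then reads s(x) <= s(x + y) - s(y),
     which is superadditivity. *)
  have syE : subl_at s y = s.
    apply: smin => [|z]; [exact: sublinear_subl_at|exact: subl_at_le_self].
  by have := subl_at_le y x ss ler01; rewrite syE scale1r mul1r; lra.
have sN x : s (- x) = - s x.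
  by apply/eqP; rewrite -addr_eq0 -sD addNr sublinear0.
have slin : scalar s.
  move=> a x y; rewrite sD; congr (_ + _).
  have [a0|a0] := leP 0 a; first exact: sublinearZ.
  by rewrite -[a in LHS]opprK scaleNr sN sublinearZ ?oppr_ge0 ?ltW// mulNr opprK.
pose sM := GRing.isLinear.Build R E R *%R s slin.
pose phi : {scalar E} := HB.pack s sM.
by exists phi.
Qed.

End HahnBanach.

Lemma norming_functional (R : realType) (E : normedModType R) (v : E) :
  exists2 phi : {scalar E}, (forall x, phi x <= `|x|) & phi v = `|v|.
Proof.
have sn : sublinear (fun x : E => `|x|).
  split=> [x y|a x a0]; first exact: ler_normD.
  by rewrite normrZ gtr0_norm.
have [phi phile] := hahn_banach (sublinear_subl_at v sn).
have phin x : phi x <= `|x| := le_trans (phile x) (subl_at_le_self v x sn).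
exists phi => //; apply/eqP; rewrite eq_le phin /= -lerN2 -raddfN.
apply: le_trans (phile _) _.
(* For t = 1 the bound at [- v] is |-v + v| - |v| = -|v|. *)
apply: le_trans (subl_at_le v (- v) sn ler01) _.
by rewrite scale1r addNr normr0 mul1r sub0r.
Qed.

(** * Common kernels of finitely many functionals, and their quotients *)

Lemma quot_map0 (R : numFieldType) (V : lmodType R) (S : submodClosed V) :
  quot_map S 0 = 0.
Proof. by rewrite -(subrr 0) quot_mapB subrr. Qed.

Lemma quot_map_sum (R : numFieldType) (V : lmodType R) (S : submodClosed V)
    n (v : 'I_n -> V) :
  quot_map S (\sum_(i < n) v i) = \sum_(i < n) quot_map S (v i).
Proof. exact: (big_morph _ (quot_mapD S) (quot_map0 S)). Qed.

Section CommonKernel.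
Variables (R : realType) (E : lmodType R).
Implicit Types (s : seq {scalar E}).

Definition common_ker s : {pred E} := [pred x | all
  (fun phi : {scalar E} => phi x == 0) s].

Lemma common_kerP s x :
  reflect (forall phi, phi \in s -> phi x = 0) (x \in common_ker s).
Proof. by apply: (iffP allP) => h phi /h/eqP. Qed.

Lemma common_ker_submod s : submod_closed (common_ker s).
Proof.
split; first by apply/common_kerP => phi _; rewrite raddf0.
move=> a x y /common_kerP xK /common_kerP yK; apply/common_kerP => phi phis.
by rewrite linearP xK// yK// mulr0 addr0.
Qed.

HB.instance Definition _ s :=
  GRing.isSubmodClosed.Build R E (common_ker s) (common_ker_submod s).

(** Induction on [s]: a functional vanishing on the kernel so far changes nothing; otherwise one
    vector of that kernel on which it is nonzero is added to the family. *)
Lemma finite_codim_common_ker s : exists n (b : 'I_n -> E), forall v,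
  exists c : 'I_n -> R, v - \sum_(i < n) c i *: b i \in common_ker s.
Proof.
elim: s => [|phi s [n [b bP]]].
  by exists 0%N, (fun=> 0) => v; exists (fun=> 0).
have [phi0|] := pselect (forall e, e \in common_ker s -> phi e = 0).
  exists n, b => v; have [c cP] := bP v; exists c.
  by rewrite inE /= phi0// eqxx.
move=> /existsNP[e /not_implyP[eK phie]].
exists n.+1, (fun i => oapp b e (unlift ord0 i)) => v.
have [c cP] := bP v.
set w := v - _ in cP.
(* This coefficient of [e] makes [phi] vanish on the remainder, which stays in the earlier kernel
   because [w] and [e] lie there. *)
exists (fun i => oapp c (phi w / phi e) (unlift ord0 i)).
rewrite big_ord_recl unlift_none /=.
under eq_bigr do rewrite !liftK /=.
rewrite addrC opprD -addrA [_ + v]addrC -/w.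
have cP' : - ((phi w / phi e) *: e) + w \in common_ker s.
  by rewrite -scaleNr; apply: (common_ker_submod s).2.
rewrite inE /=; apply/andP; split => //.
by rewrite -scaleNr linearP mulNr divfK ?addNr//; exact/eqP.
Qed.

End CommonKernel.

Section BoundedCommonKernel.
Variables (R : realType) (E : normedModType R) (s : seq {scalar E}).
Hypothesis s_bounded : forall phi, phi \in s -> forall x, phi x <= `|x|.

(** For y in the kernel within e of x, |phi(x)| = |phi(x - y)| <= |x - y| < e. *)
Lemma closed_common_ker : closed [set x | x \in common_ker s].
Proof.
move=> x xK; apply/common_kerP => phi phis; apply/eqP.
rewrite -normr_eq0 eq_le normr_ge0 andbT; apply/ler_addgt0Pr => e e0.
have [|y [yK]] := xK (ball x e); first exact: nbhsx_ballx.
rewrite -ball_normE /= add0r => xye.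
have -> : phi x = phi (x - y) by rewrite linearB /= (common_kerP _ _ yK)// subr0.
apply: le_trans (ltW xye); rewrite ler_norml s_bounded// andbT lerNl -linearN.
by rewrite (le_trans (s_bounded phis _))// normrN.
Qed.

Lemma finite_dim_quotient_common_ker : finite_dim (quotient_type (common_ker s)).
Proof.
have [n [b bP]] := finite_codim_common_ker s.
exists n, (fun i => quot_map _ (b i)) => q; have [v <-] := quot_map_surj q.
have [c cP] := bP v; exists c.
have /quot_map_eq -> := cP.
by rewrite quot_map_sum; apply: eq_bigr => i _; rewrite quot_mapZ.
Qed.

Definition common_ker_cofin : cofin_subspace E :=
  CofinSubspace closed_common_ker finite_dim_quotient_common_ker.

End BoundedCommonKernel.

Lemma norming_cofin_subspace (R : realType) (E : normedModType R) (A : seq E) :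
  exists Y : cofin_subspace E, forall v, v \in A -> `|cofin_quot_map Y v| = `|v|.
Proof.
have /choice[phi phiP] (v : E) : exists phi : {scalar E},
    (forall x, phi x <= `|x|) /\ phi v = `|v|.
  by have [phi] := norming_functional v; exists phi.
have phi_bounded f : f \in map phi A -> forall x, f x <= `|x|.
  by move=> /mapP[v _ ->]; exact: (phiP v).1.
exists (common_ker_cofin phi_bounded) => v vA.
apply/eqP; rewrite eq_le quotient_norm_le/=.
(* The functional chosen for [v] agrees on all representatives [e] of the class of [v], so it equals
   |v| at [e] and is at most |e| there. *)
apply: quotient_norm_ge => e /quot_map_eq /common_kerP/(_ _ (map_f phi vA)).
rewrite linearB /= (phiP v).2 => /eqP; rewrite subr_eq0 => /eqP <-.
exact: (phiP v).1.
Qed.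

(** * Spans of finite families as finite-dimensional subspaces *)

Section SpanSubspace.
Variables (R : realType) (V : normedModType R) (n : nat) (b : 'I_n -> V).

Definition span_pred : {pred V} := [pred v | `[< lin_span b v >]].

Lemma span_predP v : reflect (lin_span b v) (v \in span_pred).
Proof. exact: asboolP. Qed.

Lemma span_pred_submod : submod_closed span_pred.
Proof.
split.
  by apply/span_predP; exists (fun=> 0); rewrite big1// => i _; rewrite scale0r.
move=> a x y /span_predP bx /span_predP bv; apply/span_predP.
by apply: lin_spanD => //; exact: lin_spanZ.
Qed.

HB.instance Definition _ :=
  GRing.isSubmodClosed.Build R V span_pred span_pred_submod.

Lemma span_pred_mem i : b i \in span_pred.
Proof.
apply/span_predP; exists (fun j => (j == i)%:R); rewrite (bigD1 i)//= eqxx scale1r.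
by rewrite big1 ?addr0// => j /negPf ->; rewrite scale0r.
Qed.

Lemma finite_dim_span_pred : finite_dim (subspace_type span_pred).
Proof.
exists n, (fun i => exist _ (b i) (span_pred_mem i) : subspace_type span_pred) => v.
have /span_predP[c cP] := valP v; exists c; apply: val_inj.
by rewrite cP raddf_sum.
Qed.

Definition span_subspace : fin_subspace V := FinSubspace finite_dim_span_pred.

End SpanSubspace.

(** * Monotonicity of the integral *)

Section RintegralMonotone.
Context d (T : measurableType d) (R : realType) (mu : {measure set T -> \bar R}).

Import HBNNSimple.

(* Both integrals are suprema over the simple functions below the integrand, so
   no measurability is needed. *)
Lemma ge0_le_integral_nonmeas (D : set T) (f g : T -> \bar R) :
  (forall t, D t -> 0 <= f t)%E -> (forall t, D t -> f t <= g t)%E ->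
  (\int[mu]_(t in D) f t <= \int[mu]_(t in D) g t)%E.
Proof.
move=> f0 fg; rewrite !ge0_integralE//; last first.
  by move=> t Dt; apply: le_trans (f0 t Dt) (fg t Dt).
apply: ereal_sup_le => _ [h hf <-]; exists h => // t.
apply: le_trans (hf t) _; rewrite /patch; case: ifPn => //.
by rewrite inE; exact: fg.
Qed.

(** [fine] sends an infinite integral to 0 and would break monotonicity; the bound [M] on a set of
    finite measure makes both integrals finite. *)
Lemma ge0_le_Rintegral_bounded (D : set T) (f g : T -> R) (M : R) :
  measurable D -> (mu D < +oo)%E ->
  (forall t, D t -> 0 <= f t) -> (forall t, D t -> f t <= g t) ->
  (forall t, D t -> g t <= M) ->
  \int[mu]_(t in D) f t <= \int[mu]_(t in D) g t.
Proof.
move=> mD muD f0 fg gM.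
have g0 t : D t -> 0 <= g t by move=> Dt; apply: le_trans (f0 t Dt) (fg t Dt).
have gfin : (\int[mu]_(t in D) (g t)%:E < +oo)%E.
  apply: (@le_lt_trans _ _ (\int[mu]_(t in D) (cst M%:E t))%E).
    by apply: ge0_le_integral_nonmeas => t Dt; rewrite lee_fin ?g0 ?gM.
  rewrite integral_cst//.
  have : (M%:E * mu D)%E \is a fin_num by rewrite fin_numM// ge0_fin_numE.
  by move=> /fin_numPlt/andP[].
have fgi : (\int[mu]_(t in D) (f t)%:E <= \int[mu]_(t in D) (g t)%:E)%E.
  by apply: ge0_le_integral_nonmeas => t Dt; rewrite lee_fin ?f0 ?fg.
have fi0 : (0 <= \int[mu]_(t in D) (f t)%:E)%E.
  by apply: integral_ge0 => t Dt; rewrite lee_fin f0.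
rewrite /Rintegral fine_le// ge0_fin_numE//; first exact: le_lt_trans gfin.
exact: le_trans fgi.
Qed.

End RintegralMonotone.

(** * Quotient maps and Rademacher sums *)

Section CofinQuotMap.
Variables (R : realType) (E : normedModType R) (Y : cofin_subspace E).

Lemma cofin_quot_mapB u v :
  cofin_quot_map Y (u - v) = cofin_quot_map Y u - cofin_quot_map Y v.
Proof. exact: quot_mapB. Qed.

Lemma cofin_quot_map_lincomb n (c : 'I_n -> R) (w : 'I_n -> E) :
  cofin_quot_map Y (\sum_(k < n) c k *: w k) =
  \sum_(k < n) c k *: cofin_quot_map Y (w k).
Proof.
rewrite /cofin_quot_map quot_map_sum.
by apply: eq_bigr => k _; exact: quot_mapZ.
Qed.

Lemma cofin_quot_map_norm_le v : `|cofin_quot_map Y v| <= `|v|.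
Proof. exact: quotient_norm_le. Qed.

End CofinQuotMap.

Section RademacherSum.
Variables (R : realType) (E : normedModType R) (N : nat).
Variables (lambda : 'I_N -> R) (w : 'I_N -> E).

Definition rademacher_sum (t : R) : E :=
  \sum_(k < N) (lambda k * rademacher k.+1 t) *: w k.

Lemma rademacher_sum_norm_le t :
  `|rademacher_sum t| <= \sum_(k < N) `|lambda k| * `|w k|.
Proof.
apply: le_trans (ler_norm_sum _ _ _) _; apply: ler_sum => k _.
rewrite normrZ normrM ler_wpM2r// ler_piMr// /rademacher normr_sg.
by case: (_ != 0).
Qed.

(* [Num.sg 0 = 0], so that [rademacher] also vanishes at some points. *)
Definition rademacher_values : seq E :=
  [seq \sum_(k < N) (lambda k * ((s k)%:R - 1)) *: w k
  | s : {ffun 'I_N -> 'I_3}].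

Lemma rademacher_sum_value t : rademacher_sum t \in rademacher_values.
Proof.
(* The indices 0, 1, 2 encode the signs -1, 0, 1. *)
have /choice[s sP] (k : 'I_N) : exists i : 'I_3, rademacher k.+1 t = i%:R - 1 :> R.
  rewrite /rademacher; case: sgrP => _.
  - by exists (@Ordinal 3 1 isT); rewrite subrr.
  - by exists (@Ordinal 3 2 isT) => /=; lra.
  - by exists (@Ordinal 3 0 isT); rewrite sub0r.
apply/mapP; exists (finfun s); first by rewrite mem_enum.
by apply: eq_bigr => k _; rewrite ffunE sP.
Qed.

End RademacherSum.

Lemma cofin_quot_map_rademacher_sum (R : realType) (E : normedModType R)
    (Y : cofin_subspace E) N (lambda : 'I_N -> R) (w : 'I_N -> E) t :
  rademacher_sum lambda (fun k => cofin_quot_map Y (w k)) t =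
  cofin_quot_map Y (rademacher_sum lambda w t).
Proof. by rewrite cofin_quot_map_lincomb. Qed.

(** * Type inequalities for [f] and for its localizations *)

Section TypeLocal.
Variables (R : realType) (p : R) (X E : completeNormedModType R) (f : X -> E).

Definition localize (Z : fin_subspace X) (Y : cofin_subspace E) :
    fin_subspace_type Z -> cofin_quotient Y :=
  cofin_quot_map Y \o f \o @fin_incl R X Z.

Lemma localize_sum Z Y N (lambda : 'I_N -> R)
    (x y : 'I_N -> fin_subspace_type Z) t :
  \sum_(k < N) (lambda k * rademacher k.+1 t) *:
    (localize Y (x k) - localize Y (y k)) =
  cofin_quot_map Y
    (rademacher_sum lambda (fun k => f (fin_incl (x k)) - f (fin_incl (y k))) t).
Proof.
rewrite -cofin_quot_map_rademacher_sum; apply: eq_bigr => k _.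
by rewrite cofin_quot_mapB.
Qed.

Lemma Lip0_localize Z Y : Lip0 f -> Lip0 (localize (Z := Z) Y).
Proof.
move=> [[k fk] f0]; split; last first.
  rewrite /localize /= /fin_incl raddf0 f0.
  exact: quot_map0.
exists k => -[x y] _ /=; rewrite /localize /= -cofin_quot_mapB.
apply: le_trans (cofin_quot_map_norm_le _ _) _.
exact: (fk (fin_incl x, fin_incl y)).
Qed.

Lemma type_ineq_localize Z Y C :
  type_ineq p f C -> type_ineq p (localize (Z := Z) Y) C.
Proof.
move=> fC N lambda x y.
(* The right-hand sides agree by conversion, the norm of [Z] being that of [X]; only the integrals
   remain to be compared. *)
apply: le_trans _ (fC N lambda (fun k => fin_incl (x k)) (fun k => fin_incl (y k))).
rewrite ler_sqrt; last by apply: Rintegral_ge0 => t _; exact: sqr_ge0.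
set w := fun k => f (fin_incl (x k)) - f (fin_incl (y k)).
have mu01 : (lebesgue_measure `[0%R, 1%R : R] < +oo)%E.
  by rewrite lebesgue_measure_itv/= lte01 -EFinD ltry.
apply: (@ge0_le_Rintegral_bounded _ _ _ _ _ _ _
  ((\sum_(k < N) `|lambda k| * `|w k|) ^+ 2)) => //.
- move=> t _; rewrite (localize_sum Y lambda x y) ler_sqr ?nnegrE//.
  exact: cofin_quot_map_norm_le.
- move=> t _; rewrite ler_sqr ?nnegrE ?sumr_ge0//.
  exact: rademacher_sum_norm_le.
Qed.

Lemma type_consts_localize Z Y :
  type_consts p f `<=` type_consts p (localize (Z := Z) Y).
Proof. by move=> C [C0 fC]; split=> //; exact: type_ineq_localize. Qed.

Lemma type_ineq_localized C :
  (forall Z Y, type_ineq p (localize (Z := Z) Y) C) -> type_ineq p f C.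
Proof.
move=> fC N lambda x y.
(* The points x_k followed by the points y_k, so that their span contains both families. *)
pose b (i : 'I_(N + N)) :=
  match fintype.split i with inl k => x k | inr k => y k end.
have bx k : b (lshift N k) = x k by rewrite /b (unsplitK (inl k)).
have by_ k : b (rshift N k) = y k by rewrite /b (unsplitK (inr k)).
pose Z := span_subspace b.
pose basis i : fin_subspace_type Z := exist _ (b i) (span_pred_mem b i).
have [Y YP] := norming_cofin_subspace
  (rademacher_values lambda (fun k => f (x k) - f (y k))).
(* Both outer inequalities are equalities: [Y] preserves the norm of every value of the sum, and [Z]
   carries the norm of [X]. *)
apply: le_trans (le_trans (fC Z Y N lambda
  (fun k => basis (lshift N k)) (fun k => basis (rshift N k))) _);
  rewrite le_eqVlt; apply/predU1P; left.
  congr (Num.sqrt _); apply: eq_Rintegral => t _; rewrite (localize_sum Y lambda).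
  rewrite -[in LHS]YP ?rademacher_sum_value//.
  congr (`|cofin_quot_map Y _| ^+ 2); apply: eq_bigr => k _.
  by rewrite /fin_incl /= bx by_.
congr (_ * _ `^ _); apply: eq_bigr => k _; congr (_ * _ `^ _).
by rewrite -[LHS]/(`|b _ - b _|) bx by_.
Qed.

End TypeLocal.

Lemma type_ineq_le (R : realType) (p : R) (X E : normedModType R) (f : X -> E)
    C C' :
  C <= C' -> type_ineq p f C -> type_ineq p f C'.
Proof.
move=> CC' fC N lambda x y; apply: le_trans (fC N lambda x y) _.
by rewrite ler_wpM2r// powR_ge0.
Qed.

(** * The type norm compared with the supremum over localizations *)

Section TypeConstsInf.
Variables (R : realType) (p : R) (X E : completeNormedModType R) (f : X -> E).

Lemma inf_type_consts_le C : type_consts p f C -> inf (type_consts p f) <= C.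
Proof. by move=> fC; apply: ge_inf => //; exists 0 => D [/ltW]. Qed.

Lemma inf_type_consts_ge0 : 0 <= inf (type_consts p f).
Proof.
have [A0|nA0] := pselect (type_consts p f !=set0).
  by apply: lb_le_inf => // C [/ltW].
(* Without constants the infimum is the default value 0. *)
by rewrite inf_out// => -[].
Qed.

(** The set of constants is upward closed, so it contains every number strictly above its
    infimum. *)
Lemma inf_type_consts_lt C : type_consts p f !=set0 ->
  inf (type_consts p f) < C -> type_consts p f C.
Proof.
move=> f0 /(inf_lt f0)[D [D0 fD] DC].
by split; [exact: lt_trans DC|exact: type_ineq_le (ltW DC) fD].
Qed.

End TypeConstsInf.

Section TypeMax.
Variables (R : realType) (p : R) (X E : completeNormedModType R) (f : X -> E).

Local Notation enorm Z Y := (lip_enorm (type_class p) (localize (Z := Z) f Y)).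

Lemma type_enorm_ge0 Z Y : (0 <= enorm Z Y)%E.
Proof.
rewrite /lip_enorm; case: ifP => // _; rewrite lee_fin.
exact: inf_type_consts_ge0.
Qed.

Lemma type_enorm_le_max Z Y : (enorm Z Y <= lip_max_enorm (type_class p) f)%E.
Proof. by apply: ereal_sup_ubound; exists (Z, Y). Qed.

Lemma type_max_enorm_le : type_component p f ->
  (lip_max_enorm (type_class p) f <= (inf (type_consts p f))%:E)%E.
Proof.
move=> [fL f0]; apply: ge_ereal_sup => _ [[Z Y] _ <-].
have sub := @type_consts_localize R p X E f Z Y.
have gL : type_component p (localize (Z := Z) f Y).
  by split; [exact: Lip0_localize|case: f0 => C /sub fC; exists C].
rewrite /lip_enorm asboolT// lee_fin.
by apply: lb_le_inf => // C /sub; exact: inf_type_consts_le.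
Qed.

Lemma type_max_enorm_ge : Lip0 f -> (lip_max_enorm (type_class p) f < +oo)%E ->
  type_component p f /\
  ((inf (type_consts p f))%:E <= lip_max_enorm (type_class p) f)%E.
Proof.
move=> fL maxoo; set M := lip_max_enorm _ _ in maxoo *.
(* The value -oo is excluded because the supremum runs over a nonempty family of nonnegative values:
   [Z] may be the span of the empty family. *)
have Mfin : M \is a fin_num.
  have [Y _] := @norming_cofin_subspace R E [::].
  rewrite ge0_fin_numE//.
  apply: le_trans (type_enorm_le_max (span_subspace (fun=> 0 : X) (n := 0)) Y).
  exact: type_enorm_ge0.
have fC C : fine M < C -> type_consts p f C.
  move=> MC.
  have gC Z Y : type_consts p (localize (Z := Z) f Y) C.
    have := type_enorm_le_max Z Y; rewrite -/M -(fineK Mfin) /lip_enorm.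
    (* A localization outside the component would have norm +oo, against the finiteness of [M]. *)
    case: asboolP => [[_ g0]|_]; last by rewrite leye_eq.
    rewrite lee_fin => gM; apply: inf_type_consts_lt => //.
    exact: le_lt_trans MC.
  have [Y _] := @norming_cofin_subspace R E [::].
  (* Any single localization yields the positivity of [C]. *)
  have C0 := (gC (span_subspace (fun=> 0 : X) (n := 0)) Y).1.
  by split=> //; apply: type_ineq_localized => Z Y'; exact: (gC Z Y').2.
split.
  by split=> //; exists (fine M + 1); apply: fC; rewrite ltrDl.
rewrite -(fineK Mfin) lee_fin; apply/ler_addgt0Pr => e e0.
by apply: inf_type_consts_le; apply: fC; rewrite ltrDl.
Qed.

End TypeMax.

Theorem theorem3p12 (R : realType) (p : R) (p_gt1 : 1 < p) (p_le2 : p <= 2) :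
  lip_maximal (type_class p).
Proof.
move=> X E.
have fmax (f : X -> E) : type_component p f ->
    lip_max_enorm (type_class p) f = (inf (type_consts p f))%:E.
  move=> fT; have le := type_max_enorm_le fT; apply/eqP; rewrite eq_le le.
  by have [_ ->] := type_max_enorm_ge fT.1 (le_lt_trans le (ltry _)).
split=> [|f fT]; last by rewrite /= fmax.
apply/seteqP; split=> f.
  by move=> fT; split; [exact: fT.1|rewrite fmax// ltry].
by move=> [fL maxoo]; have [] := type_max_enorm_ge fL maxoo.
Qed.
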